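(* Let $\mathcal S$ be the class of all simple totally ordered idempotent RLs. Then the variety generated by $\mathcal S$ has surjective epimorphisms (the ES property).
   Context: A (commutative) residuated lattice (RL) is an algebra $\langle A;\cdot,\to,\wedge,\vee,e\rangle$ such that $\langle A;\cdot,e\rangle$ is a commutative monoid, $\langle A;\wedge,\vee\rangle$ is a lattice, and $x\cdot y\leqslant z \iff y\leqslant x\to z$. It is idempotent if $a\cdot a=a$ for all $a$. An algebra is simple if it has exactly two congruences. For a class $\mathcal K$ of similar algebras, a homomorphism $f\colon\mathbf A\to\mathbf B$ with $\mathbf A,\mathbf B\in\mathcal K$ is a $\mathcal K$-epimorphism if for all homomorphisms $g,h\colon\mathbf B\to\mathbf C$ with $\mathbf C\in\mathcal K$, $g\circ f=h\circ f$ implies $g=h$; $\mathcal K$ has the ES property if every $\mathcal K$-epimorphism is surjective. *)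

(* Defs.v *)
From Stdlib Require Import Relations FinFun.

Record RL : Type := mkRL {
  carrier :> Type;
  mul : carrier -> carrier -> carrier;
  imp : carrier -> carrier -> carrier;
  meet : carrier -> carrier -> carrier;
  join : carrier -> carrier -> carrier;
  one : carrier;
  mulA : forall x y z, mul x (mul y z) = mul (mul x y) z;
  mulC : forall x y, mul x y = mul y x;
  mul1 : forall x, mul one x = x;
  meetA : forall x y z, meet x (meet y z) = meet (meet x y) z;
  meetC : forall x y, meet x y = meet y x;
  joinA : forall x y z, join x (join y z) = join (join x y) z;
  joinC : forall x y, join x y = join y x;
  meetK : forall x y, meet x (join x y) = x;
  joinK : forall x y, join x (meet x y) = x;
  (* [u <= v] is spelled out as [u /\ v = u], the lattice order. *)
  residuation : forall x y z,
    meet (mul x y) z = mul x y <-> meet y (imp x z) = y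
}.

Arguments mul {r} _ _.
Arguments imp {r} _ _.
Arguments meet {r} _ _.
Arguments join {r} _ _.
Arguments one {r}.

Definition le {A : RL} (x y : A) : Prop := meet x y = x.

Definition idempotent (A : RL) : Prop := forall a : A, mul a a = a.

Definition totally_ordered (A : RL) : Prop :=
  forall x y : A, le x y \/ le y x.

Definition compatible {A : RL} (R : relation A) (op : A -> A -> A) : Prop :=
  forall x x' y y', R x x' -> R y y' -> R (op x y) (op x' y').

Record congruence {A : RL} (R : relation A) : Prop := {
  cong_equiv : equivalence A R;
  cong_mul : compatible R mul;
  cong_imp : compatible R imp;
  cong_meet : compatible R meet;
  cong_join : compatible R join
}.

(* Exactly two congruences; relations are counted up to extensional equality. *)
Definition simple (A : RL) : Prop :=
  exists R1 R2 : relation A,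
    congruence R1 /\ congruence R2 /\ ~ same_relation A R1 R2 /\
    forall R : relation A, congruence R ->
      same_relation A R R1 \/ same_relation A R R2.

Record hom (A B : RL) : Type := mkHom {
  hom_fun :> A -> B;
  hom_mul : forall x y, hom_fun (mul x y) = mul (hom_fun x) (hom_fun y);
  hom_imp : forall x y, hom_fun (imp x y) = imp (hom_fun x) (hom_fun y);
  hom_meet : forall x y, hom_fun (meet x y) = meet (hom_fun x) (hom_fun y);
  hom_join : forall x y, hom_fun (join x y) = join (hom_fun x) (hom_fun y);
  hom_one : hom_fun one = one
}.

Inductive term : Type :=
| tVar (n : nat)
| tOne
| tMul (s t : term)
| tImp (s t : term)
| tMeet (s t : term)
| tJoin (s t : term).

Fixpoint eval {A : RL} (v : nat -> A) (t : term) : A :=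
  match t with
  | tVar n => v n
  | tOne => one
  | tMul s t => mul (eval v s) (eval v t)
  | tImp s t => imp (eval v s) (eval v t)
  | tMeet s t => meet (eval v s) (eval v t)
  | tJoin s t => join (eval v s) (eval v t)
  end.

(* A set of equations is a relation on terms: [E s t] means [s = t] is in it. *)
Definition satisfies (A : RL) (E : relation term) : Prop :=
  forall s t, E s t -> forall v : nat -> A, eval v s = eval v t.

(* A variety (of RLs) is an equationally definable class. *)
Definition variety (K : RL -> Prop) : Prop :=
  exists E : relation term, forall A : RL, K A <-> satisfies A E.

Definition generated_variety (S : RL -> Prop) (A : RL) : Prop :=
  forall K : RL -> Prop, variety K -> (forall B, S B -> K B) -> K A.

Definition epimorphism (K : RL -> Prop) {A B : RL} (f : hom A B) : Prop :=
  forall C : RL, K C -> forall g h : hom B C,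
    (forall a : A, g (f a) = h (f a)) -> forall b : B, g b = h b.

Definition ES_property (K : RL -> Prop) : Prop :=
  forall A B : RL, K A -> K B ->
    forall f : hom A B, epimorphism K f -> Surjective f.

Definition simple_idempotent_chain (A : RL) : Prop :=
  simple A /\ totally_ordered A /\ idempotent A.

(* Main.v *)
From Stdlib Require Import Relations FinFun Classical ClassicalEpsilon.
From Stdlib Require Import FunctionalExtensionality PropExtensionality.
From Stdlib Require Import ProofIrrelevance.
From mathcomp Require classical_sets.
Require Import Defs.

(**
In a simple idempotent chain [A] the elements below [one] are [one] and a least
element, and the operations are determined by the order; hence a missing element
of a subalgebra can be moved to a new position immediately above it, and proper
subalgebras of simple chains are never epic. Quotients of a member [B] of the
variety by prime filters are such chains (or trivial), so an epimorphism [f] into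
[B] becomes onto modulo each prime filter. Consequently a prime filter of [B] is
determined on the negative cone by its trace on the image of [f], and prime
separation puts the whole negative cone into the image. Finally, given [b] in [B],
local preimages of [b] are patched by a switching term whose control parameter
lies in the negative cone, so that [b] itself is in the image.
*)

(** * Residuated lattices *)

Lemma le_refl {A : RL} (x : A) : le x x.
Proof.
  unfold le. rewrite <- (joinK A x x) at 2. apply meetK.
Qed.

Lemma le_trans {A : RL} (x y z : A) : le x y -> le y z -> le x z.
Proof.
  unfold le; intros H1 H2. rewrite <- H1 at 1. rewrite <- meetA, H2. exact H1.
Qed.

Lemma le_antisym {A : RL} (x y : A) : le x y -> le y x -> x = y.
Proof.
  unfold le; intros H1 H2. rewrite <- H1, meetC. exact H2.
Qed.

Lemma meet_le_l {A : RL} (x y : A) : le (meet x y) x.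
Proof.
  unfold le. rewrite (meetC A x y), <- meetA. f_equal. apply le_refl.
Qed.

Lemma meet_le_r {A : RL} (x y : A) : le (meet x y) y.
Proof. rewrite meetC. apply meet_le_l. Qed.

Lemma le_meet {A : RL} (x y z : A) : le z x -> le z y -> le z (meet x y).
Proof. unfold le; intros H1 H2. now rewrite meetA, H1. Qed.

Lemma le_join_l {A : RL} (x y : A) : le x (join x y).
Proof. apply meetK. Qed.

Lemma le_join_r {A : RL} (x y : A) : le y (join x y).
Proof. rewrite joinC. apply meetK. Qed.

Lemma le_iff_join {A : RL} (x y : A) : le x y <-> join x y = y.
Proof.
  unfold le; split; intro H.
  - now rewrite <- H, joinC, meetC, joinK.
  - rewrite <- H. apply meetK.
Qed.

Lemma join_le {A : RL} (x y z : A) : le x z -> le y z -> le (join x y) z.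
Proof.
  rewrite !le_iff_join; intros H1 H2. now rewrite <- joinA, H2.
Qed.

Lemma meet_eq_l {A : RL} (x y : A) : le x y -> meet x y = x.
Proof. exact (fun H => H). Qed.

Lemma meet_eq_r {A : RL} (x y : A) : le y x -> meet x y = y.
Proof. rewrite meetC. exact (fun H => H). Qed.

Lemma join_eq_r {A : RL} (x y : A) : le x y -> join x y = y.
Proof. apply le_iff_join. Qed.

Lemma join_eq_l {A : RL} (x y : A) : le y x -> join x y = x.
Proof. rewrite joinC. apply le_iff_join. Qed.

Lemma le_imp {A : RL} (x y z : A) : le (mul x y) z <-> le y (imp x z).
Proof. apply residuation. Qed.

Lemma le_imp' {A : RL} (x y z : A) : le (mul x y) z <-> le x (imp y z).
Proof. rewrite mulC. apply le_imp. Qed.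

Lemma le_impI {A : RL} (x y z : A) : le (mul x y) z -> le y (imp x z).
Proof. apply le_imp. Qed.

Lemma mul1r {A : RL} (x : A) : mul x one = x.
Proof. rewrite mulC. apply mul1. Qed.

Lemma mul_imp_le {A : RL} (x y : A) : le (mul x (imp x y)) y.
Proof. apply le_imp, le_refl. Qed.

Lemma mul_le_r {A : RL} (x y z : A) : le y z -> le (mul x y) (mul x z).
Proof.
  intro H. apply le_imp. apply le_trans with z; [exact H|].
  apply le_imp, le_refl.
Qed.

Lemma mul_le {A : RL} (x x' y y' : A) :
  le x x' -> le y y' -> le (mul x y) (mul x' y').
Proof.
  intros H1 H2. apply le_trans with (mul x y'); [now apply mul_le_r|].
  rewrite (mulC A x), (mulC A x'). now apply mul_le_r.
Qed.

Lemma mul_join {A : RL} (x y z : A) :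
  mul x (join y z) = join (mul x y) (mul x z).
Proof.
  apply le_antisym.
  - apply le_imp, join_le; apply le_imp; [apply le_join_l|apply le_join_r].
  - apply join_le; apply mul_le_r; [apply le_join_l|apply le_join_r].
Qed.

Lemma one_le_imp {A : RL} (x y : A) : le one (imp x y) <-> le x y.
Proof. rewrite <- le_imp, mul1r. reflexivity. Qed.

Lemma imp_one_l {A : RL} (x : A) : imp one x = x.
Proof.
  apply le_antisym.
  - rewrite <- (mul1 A (imp one x)). apply mul_imp_le.
  - apply le_imp. rewrite mul1. apply le_refl.
Qed.

Lemma imp_imp {A : RL} (x y z : A) : imp (mul x y) z = imp y (imp x z).
Proof.
  apply le_antisym.
  - apply le_impI, le_impI. rewrite mulA. apply mul_imp_le.
  - apply le_impI. rewrite <- mulA.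
    apply le_trans with (mul x (imp x z)); [|apply mul_imp_le].
    apply mul_le_r, mul_imp_le.
Qed.

Lemma imp_comp {A : RL} (x y z : A) :
  le (mul (imp x y) (imp y z)) (imp x z).
Proof.
  apply le_impI. rewrite mulA.
  apply le_trans with (mul y (imp y z)); [|apply mul_imp_le].
  apply mul_le; [apply mul_imp_le|apply le_refl].
Qed.

(** Residuation turns [mul a x <= a] into [a <= imp x a], an instance of the hypothesis. *)
Lemma mul_least {A : RL} (a x : A) : (forall y, le a y) -> mul a x = a.
Proof.
  intro H. apply le_antisym; [|apply H]. apply le_imp'. apply H.
Qed.

(** One inequality writes the idempotent [join x y] as its own square; the other multiplies [x] and
    [y] by [one]. *)
Lemma mul_eq_join {A : RL} (x y : A) :
  idempotent A -> le one x -> le one y -> mul x y = join x y.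
Proof.
  intros Hi Hx Hy. apply le_antisym.
  - rewrite <- (Hi (join x y)). apply mul_le; [apply le_join_l|apply le_join_r].
  - apply join_le.
    + rewrite <- (mul1r x) at 1. now apply mul_le_r.
    + rewrite <- (mul1 A y) at 1. apply mul_le; [exact Hx|apply le_refl].
Qed.

Definition hom_comp {A B C : RL} (g : hom B C) (f : hom A B) : hom A C.
Proof.
  refine (mkHom A C (fun x => g (f x)) _ _ _ _ _); intros.
  - now rewrite !hom_mul.
  - now rewrite !hom_imp.
  - now rewrite !hom_meet.
  - now rewrite !hom_join.
  - now rewrite !hom_one.
Defined.

(** Competes with the projection in [epimorphism_onto_prime_quotient] when the image of [A] is
    trivial. *)
Definition hom_const_one (A B : RL) : hom A B.
Proof.
  refine (mkHom A B (fun _ => one) _ _ _ _ _); intros.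
  - now rewrite mul1.
  - now rewrite imp_one_l.
  - symmetry; apply le_refl.
  - symmetry; apply le_iff_join, le_refl.
  - reflexivity.
Defined.

(** * Simple idempotent chains *)

Definition least_below_one (A : RL) : Prop :=
  forall a : A, le a one -> a = one \/ forall x, le a x.

Lemma equality_congruence (A : RL) : congruence (@eq A).
Proof.
  split; try (intros x x' y y' -> ->; reflexivity).
  split; congruence.
Qed.

Lemma total_congruence (A : RL) : congruence (fun _ _ : A => True).
Proof. repeat split. Qed.

(* For [a <= one] idempotent this is the congruence collapsing [a] and [one]. *)
Definition collapse {A : RL} (a : A) (x y : A) : Prop :=
  le (mul a x) y /\ le (mul a y) x.

(** Idempotence of [a] yields transitivity, and provides one copy of [a] for each argument of [mul]
    and [imp]; [a <= one] yields reflexivity. *)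
Lemma collapse_congruence {A : RL} (a : A) :
  le a one -> mul a a = a -> congruence (collapse a).
Proof.
  intros Ha Haa.
  assert (Hdup : forall x y z w : A,
            le (mul a x) z -> le (mul a y) w -> le (mul a (mul x y)) (mul z w)).
  { intros x y z w H1 H2.
    replace (mul a (mul x y)) with (mul (mul a x) (mul a y)).
    - now apply mul_le.
    - rewrite <- Haa at 3.
      rewrite <- !mulA. f_equal. rewrite !mulA. f_equal. apply mulC. }
  assert (Hx : forall x, le (mul a x) x).
  { intro x. rewrite <- (mul1 A x) at 2. apply mul_le; [exact Ha|apply le_refl]. }
  split.
  - split.
    + intro x; split; apply Hx.
    + assert (Htr : forall x y z, le (mul a x) y -> le (mul a y) z ->
                                  le (mul a x) z).
      { intros x y z H1 H2. rewrite <- Haa, <- mulA.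
        eapply le_trans; [|exact H2]. now apply mul_le_r. }
      intros x y z [H1 H2] [H3 H4]; split; eauto.
    + intros x y [H1 H2]; now split.
  - intros x x' y y' [H1 H2] [H3 H4]; split; now apply Hdup.
  - assert (Himp : forall x x' y y' : A, le (mul a x') x -> le (mul a y) y' ->
                     le (mul a (imp x y)) (imp x' y')).
    { intros x x' y y' H1 H2. apply le_impI.
      apply le_trans with (mul a y); [|exact H2].
      replace (mul x' (mul a (imp x y)))
        with (mul a (mul (mul a x') (imp x y)))
        by now rewrite !mulA, Haa, (mulC A a x').
      apply mul_le_r, le_trans with (mul x (imp x y)); [|apply mul_imp_le].
      apply mul_le; [exact H1|apply le_refl]. }
    intros x x' y y' [H1 H2] [H3 H4]; split; now apply Himp.
  - intros x x' y y' [H1 H2] [H3 H4]; split; apply le_meet;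
      (eapply le_trans; [apply mul_le_r, meet_le_l|assumption]) ||
      (eapply le_trans; [apply mul_le_r, meet_le_r|assumption]).
  - intros x x' y y' [H1 H2] [H3 H4]; split; rewrite mul_join; apply join_le;
      eapply le_trans; try eassumption; apply le_join_l || apply le_join_r.
Qed.

(** For [a <> one] the congruence [collapse a] is not equality, so simplicity makes it total;
    relating [one] to [x] it then says [a <= x]. *)
Lemma simple_least_below_one (A : RL) :
  idempotent A -> simple A -> least_below_one A.
Proof.
  intros Hi (R1 & R2 & _ & _ & _ & Htwo) a Ha.
  destruct (classic (a = one)) as [|Hne]; [now left|right; intro x].
  assert (Hc : collapse a one a).
  { split; [rewrite mul1r; apply le_refl|rewrite Hi; exact Ha]. }
  assert (Heq : ~ same_relation A (collapse a) eq).
  { intros [H _]. apply Hne. symmetry. now apply H. }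
  enough (Hs : same_relation A (collapse a) (fun _ _ => True)).
  { destruct Hs as [_ Hs]. destruct (Hs one x I) as [H _].
    now rewrite mul1r in H. }
  assert (Hsym : forall R S T : relation A,
            same_relation A R S -> same_relation A T S -> same_relation A R T).
  { intros R S T [H1 H2] [H3 H4]; split; intros u v K; auto. }
  assert (Htot : ~ same_relation A (fun _ _ => True) eq).
  { intros [H _]. apply Hne. now apply H. }
  (* Pigeonhole: three congruences fall into two classes, and equality shares its class with neither
     of the others. *)
  destruct (Htwo _ (collapse_congruence a Ha (Hi a)));
    destruct (Htwo _ (total_congruence A));
    destruct (Htwo _ (equality_congruence A));
    try (exfalso; now eauto); eauto.
Qed.

(** A congruence relating [x] to [y] with [y <= x] false also relates [meet (imp y x) one] to [one].
    That meet is not [one], hence is least, and multiplying the relation by any [z] relates the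
    least element to [z]. The element [a] only separates equality from the total relation. *)
Lemma simple_chainI (A : RL) (a : A) :
  totally_ordered A -> idempotent A -> least_below_one A -> a <> one ->
  simple_idempotent_chain A.
Proof.
  intros Ht Hi Hl Ha. split; [|now split].
  exists eq, (fun _ _ => True).
  split; [apply equality_congruence|split; [apply total_congruence|split]].
  { intros [_ H]. apply Ha. now apply H. }
  intros R HR. destruct (cong_equiv _ HR) as [Rr Rt Rs].
  destruct (classic (forall x y, R x y -> x = y)) as [He|He].
  { left; split; intros x y H; [now apply He|subst; apply Rr]. }
  right; split; [now intros ? ? ?|].
  assert (Hlt : exists x y, R x y /\ ~ le y x).
  { apply not_all_ex_not in He as [x He]. apply not_all_ex_not in He as [y He].
    apply imply_to_and in He as [Hxy Hne].
    destruct (classic (le y x)) as [Hyx|]; [|now exists x, y].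
    exists y, x; split; [now apply Rs|intro; apply Hne; now apply le_antisym]. }
  destruct Hlt as (x & y & Hxy & Hyx).
  assert (H0 : R (meet (imp y x) one) one).
  { assert (E : meet (imp y y) one = one)
      by apply meet_eq_r, one_le_imp, le_refl.
    rewrite <- E at 2.
    apply (cong_meet _ HR); [apply (cong_imp _ HR)|]; auto. }
  destruct (Hl _ (meet_le_r (imp y x) one)) as [E|Hbot].
  { exfalso; apply Hyx, one_le_imp. unfold le. now rewrite meetC. }
  set (bot := meet (imp y x) one) in *.
  assert (Hall : forall z, R bot z).
  { intro z. rewrite <- (mul_least bot z Hbot). rewrite <- (mul1 A z) at 2.
    now apply (cong_mul _ HR). }
  intros u v _. apply Rt with bot; auto.
Qed.

Lemma simple_chain_least_below_one (A : RL) :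
  simple_idempotent_chain A -> least_below_one A.
Proof. intros (Hs & _ & Hi). now apply simple_least_below_one. Qed.

Lemma bot_or_one_le {A : RL} (bot x : A) :
  totally_ordered A -> least_below_one A -> (forall y, le bot y) ->
  x = bot \/ le one x.
Proof.
  intros Ht Hl Hb. destruct (Ht x one) as [H|]; [|now right].
  destruct (Hl x H) as [->|Hx]; [right; apply le_refl|left].
  now apply le_antisym.
Qed.

Lemma simple_chain_generated (A : RL) :
  simple_idempotent_chain A -> generated_variety simple_idempotent_chain A.
Proof. intros H K _ HK. now apply HK. Qed.

(** The models of a single equation form a variety, which includes the generated one as soon as it
    includes [S]. *)
Lemma generated_equation (S : RL -> Prop) (s t : term) :
  (forall A, S A -> forall v : nat -> A, eval v s = eval v t) ->
  forall A, generated_variety S A ->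
  forall v : nat -> A, eval v s = eval v t.
Proof.
  intros HS A HA.
  apply (HA (fun B => forall v : nat -> B, eval v s = eval v t)); [|exact HS].
  exists (fun s' t' => s' = s /\ t' = t). intro B; split.
  - intros H s' t' [-> ->]. exact H.
  - intros H. now apply H.
Qed.

(** * Filters and quotients *)

Record filter {A : RL} (F : A -> Prop) : Prop := {
  filter_one : F one;
  filter_up : forall x y, F x -> le x y -> F y;
  filter_meet : forall x y, F x -> F y -> F (meet x y)
}.

(* Only joins equal to [one] are tested, and the improper filter is allowed. *)
Definition prime_filter {A : RL} (F : A -> Prop) : Prop :=
  filter F /\ forall p q, join p q = one -> F p \/ F q.

Lemma filter_mul {A : RL} (F : A -> Prop) (x y : A) :
  idempotent A -> filter F -> F x -> F y -> F (mul x y).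
Proof.
  intros Hi HF Hx Hy. apply (filter_up F HF (meet x y)).
  - now apply filter_meet.
  - rewrite <- (Hi (meet x y)). apply mul_le; [apply meet_le_l|apply meet_le_r].
Qed.

Definition filter_le {A : RL} (F : A -> Prop) (x y : A) : Prop := F (imp x y).

Definition filter_eq {A : RL} (F : A -> Prop) (x y : A) : Prop :=
  filter_le F x y /\ filter_le F y x.

Lemma filter_le_of_le {A : RL} (F : A -> Prop) (x y : A) :
  filter F -> le x y -> filter_le F x y.
Proof.
  intros HF H. apply (filter_up F HF one); [apply filter_one, HF|].
  now apply one_le_imp.
Qed.

Lemma filter_le_trans {A : RL} (F : A -> Prop) (x y z : A) :
  idempotent A -> filter F ->
  filter_le F x y -> filter_le F y z -> filter_le F x z.
Proof.
  intros Hi HF Hx Hy. eapply (filter_up F HF); [|apply (imp_comp x y z)].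
  now apply filter_mul.
Qed.

Lemma filter_eq_equiv {A : RL} (F : A -> Prop) :
  idempotent A -> filter F -> equivalence A (filter_eq F).
Proof.
  intros Hi HF. split.
  - intro x; split; apply filter_le_of_le; auto using le_refl.
  - intros x y z [H1 H2] [H3 H4]; split; eauto using filter_le_trans.
  - intros x y [H1 H2]; now split.
Qed.

Lemma filter_le_mul {A : RL} (F : A -> Prop) (x x' y y' : A) :
  idempotent A -> filter F -> filter_le F x x' -> filter_le F y y' ->
  filter_le F (mul x y) (mul x' y').
Proof.
  intros Hi HF.
  assert (Hl : forall x x' y : A, filter_le F x x' ->
                 filter_le F (mul x y) (mul x' y)).
  { intros u u' w H. apply (filter_up F HF _ _ H).
    apply le_impI. rewrite (mulC A u w), <- mulA, (mulC A u' w).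
    apply mul_le_r, mul_imp_le. }
  intros H1 H2. apply filter_le_trans with (mul x' y); auto.
  rewrite (mulC A x' y), (mulC A x' y'). auto.
Qed.

Lemma filter_le_imp {A : RL} (F : A -> Prop) (x x' y y' : A) :
  idempotent A -> filter F -> filter_le F x' x -> filter_le F y y' ->
  filter_le F (imp x y) (imp x' y').
Proof.
  intros Hi HF H1 H2. apply filter_le_trans with (imp x' y); auto.
  - apply (filter_up F HF _ _ H1), le_imp', imp_comp.
  - apply (filter_up F HF _ _ H2), le_impI, imp_comp.
Qed.

Lemma filter_le_meet {A : RL} (F : A -> Prop) (x x' y y' : A) :
  filter F -> filter_le F x x' -> filter_le F y y' ->
  filter_le F (meet x y) (meet x' y').
Proof.
  intros HF H1 H2. apply (filter_up F HF _ _ (filter_meet F HF _ _ H1 H2)).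
  apply le_impI, le_meet.
  - eapply le_trans; [|apply (mul_imp_le x)].
    apply mul_le; apply meet_le_l.
  - eapply le_trans; [|apply (mul_imp_le y)].
    apply mul_le; apply meet_le_r.
Qed.

Lemma filter_le_join {A : RL} (F : A -> Prop) (x x' y y' : A) :
  filter F -> filter_le F x x' -> filter_le F y y' ->
  filter_le F (join x y) (join x' y').
Proof.
  intros HF H1 H2. apply (filter_up F HF _ _ (filter_meet F HF _ _ H1 H2)).
  apply le_impI. rewrite mulC, mul_join. apply join_le; rewrite mulC.
  - eapply le_trans; [apply mul_le_r, meet_le_l|].
    eapply le_trans; [apply mul_imp_le|apply le_join_l].
  - eapply le_trans; [apply mul_le_r, meet_le_r|].
    eapply le_trans; [apply mul_imp_le|apply le_join_r].
Qed.

Lemma filter_eq_congruence {A : RL} (F : A -> Prop) :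
  idempotent A -> filter F -> congruence (filter_eq F).
Proof.
  intros Hi HF. split; [now apply filter_eq_equiv| | | |];
    intros x x' y y' [H1 H2] [H3 H4]; split.
  all: auto using filter_le_mul, filter_le_imp, filter_le_meet, filter_le_join.
Qed.

Lemma filter_eq_meet {A : RL} (F : A -> Prop) (x y : A) :
  filter F -> filter_eq F (meet x y) x <-> filter_le F x y.
Proof.
  intros HF; split.
  - intros [_ H]. apply (filter_up F HF _ _ H).
    apply le_impI. eapply le_trans; [apply mul_imp_le|apply meet_le_r].
  - intro H; split; [apply filter_le_of_le; auto using meet_le_l|].
    assert (Hx : filter_le F x x) by now apply filter_le_of_le, le_refl.
    rewrite <- (meet_eq_l x x) at 1 by apply le_refl.
    now apply filter_le_meet.
Qed.

Lemma filter_eq_one {A : RL} (F : A -> Prop) (p : A) :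
  filter F -> le p one -> filter_eq F p one <-> F p.
Proof.
  intros HF Hp. unfold filter_eq, filter_le. rewrite imp_one_l.
  split; [tauto|split; [now apply filter_le_of_le|assumption]].
Qed.

(** Equivalent elements have equal classes as predicates, so [epsilon] picks the same member for
    both; the quotient can then be carried by the fixed points of this choice. *)
Definition representative {A : RL} (F : A -> Prop) (x : A) : A :=
  epsilon (inhabits one) (filter_eq F x).

Lemma representative_spec {A : RL} (F : A -> Prop) (x : A) :
  filter F -> filter_eq F x (representative F x).
Proof.
  intro HF. apply (epsilon_spec _ (filter_eq F x)). exists x.
  split; apply filter_le_of_le; auto using le_refl.
Qed.

Lemma representative_eq {A : RL} (F : A -> Prop) (x y : A) :
  idempotent A -> filter F ->
  representative F x = representative F y <-> filter_eq F x y.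
Proof.
  intros Hi HF. destruct (filter_eq_equiv F Hi HF) as [_ Ht Hs]. split; intro H.
  - apply Ht with (representative F x); [now apply representative_spec|].
    apply Hs. rewrite H. now apply representative_spec.
  - unfold representative. f_equal. apply functional_extensionality; intro z.
    apply propositional_extensionality; split; intro; eapply Ht; eauto.
Qed.

Definition quotient_carrier {A : RL} (F : A -> Prop) : Type :=
  {x : A | representative F x = x}.

Definition quotient_class {A : RL} (F : A -> Prop)
  (Hi : idempotent A) (HF : filter F) (x : A) : quotient_carrier F :=
  exist _ (representative F x)
    (eq_sym (proj2 (representative_eq F _ _ Hi HF) (representative_spec F x HF))).

Lemma quotient_class_eq {A : RL} (F : A -> Prop) Hi HF (x y : A) :
  quotient_class F Hi HF x = quotient_class F Hi HF y <-> filter_eq F x y.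
Proof.
  rewrite <- (representative_eq F x y Hi HF). split; intro H.
  - exact (f_equal (@proj1_sig _ _) H).
  - apply eq_sig_hprop; [intros; apply proof_irrelevance|exact H].
Qed.

Lemma quotient_class_surj {A : RL} (F : A -> Prop) Hi HF
  (X : quotient_carrier F) : exists x, X = quotient_class F Hi HF x.
Proof.
  exists (proj1_sig X). apply eq_sig_hprop; [intros; apply proof_irrelevance|].
  symmetry. exact (proj2_sig X).
Qed.

Definition quotient_op {A : RL} (F : A -> Prop) Hi HF (op : A -> A -> A)
  (X Y : quotient_carrier F) : quotient_carrier F :=
  quotient_class F Hi HF (op (proj1_sig X) (proj1_sig Y)).

Lemma quotient_op_class {A : RL} (F : A -> Prop) Hi HF op (x y : A) :
  compatible (filter_eq F) op ->
  quotient_op F Hi HF op (quotient_class F Hi HF x) (quotient_class F Hi HF y) =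
  quotient_class F Hi HF (op x y).
Proof.
  intro Hop. apply quotient_class_eq.
  destruct (filter_eq_equiv F Hi HF) as [_ _ Hs].
  apply Hop; apply Hs; now apply representative_spec.
Qed.

Definition quotient {A : RL} (F : A -> Prop)
  (Hi : idempotent A) (HF : filter F) : RL.
Proof.
  refine (mkRL (quotient_carrier F)
            (quotient_op F Hi HF mul) (quotient_op F Hi HF imp)
            (quotient_op F Hi HF meet) (quotient_op F Hi HF join)
            (quotient_class F Hi HF one) _ _ _ _ _ _ _ _ _ _).
  all: pose proof (filter_eq_congruence F Hi HF) as [_ Cmul Cimp Cmeet Cjoin].
  all: intro X; destruct (quotient_class_surj F Hi HF X) as [x ->];
    try (intro Y; destruct (quotient_class_surj F Hi HF Y) as [y ->]);
    try (intro Z; destruct (quotient_class_surj F Hi HF Z) as [z ->]);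
    repeat rewrite quotient_op_class by assumption.
  1-9: f_equal; auto using mulA, mulC, mul1, meetA, meetC, joinA, joinC, meetK, joinK.
  (* Both sides of residuation become membership in [F] of two implications that [imp_imp]
     identifies. *)
  rewrite !quotient_class_eq, !filter_eq_meet by assumption.
  unfold filter_le. now rewrite imp_imp.
Defined.

Definition quotient_map {A : RL} (F : A -> Prop)
  (Hi : idempotent A) (HF : filter F) : hom A (quotient F Hi HF).
Proof.
  refine (mkHom A (quotient F Hi HF) (quotient_class F Hi HF) _ _ _ _ _);
    intros; try reflexivity; symmetry; apply quotient_op_class;
    now apply filter_eq_congruence.
Defined.

Lemma quotient_map_eq {A : RL} (F : A -> Prop) Hi HF (x y : A) :
  quotient_map F Hi HF x = quotient_map F Hi HF y <-> filter_eq F x y.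
Proof. apply quotient_class_eq. Qed.

Lemma quotient_map_surj {A : RL} (F : A -> Prop) Hi HF
  (X : quotient F Hi HF) : exists x, X = quotient_map F Hi HF x.
Proof. apply quotient_class_surj. Qed.

Lemma quotient_map_le {A : RL} (F : A -> Prop) Hi HF (x y : A) :
  le (quotient_map F Hi HF x) (quotient_map F Hi HF y) <-> filter_le F x y.
Proof.
  unfold le. rewrite <- hom_meet, quotient_map_eq. now apply filter_eq_meet.
Qed.

(** * Prime filters *)

Definition ideal {A : RL} (J : A -> Prop) : Prop :=
  (forall x y, J y -> le x y -> J x) /\
  (forall x y, J x -> J y -> J (join x y)).

Lemma maximal_filter_disjoint {A : RL} (F0 J : A -> Prop) :
  filter F0 -> (forall x, F0 x -> J x -> False) ->
  exists F : A -> Prop,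
    filter F /\ (forall x, F0 x -> F x) /\ (forall x, F x -> J x -> False) /\
    forall G : A -> Prop, filter G -> (forall x, F x -> G x) ->
      (forall x, G x -> J x -> False) -> forall x, G x -> F x.
Proof.
  intros HF0 Hdis.
  (* Adjoining [F0] makes the empty chain harmless. *)
  pose (P := fun X : A -> Prop => filter (fun x => F0 x \/ X x) /\
                                  forall x, X x -> J x -> False).
  destruct (@classical_sets.Zorn_bigcup A P) as (X & [HX HXJ] & Hmax).
  - intros C HC Htot. split.
    + split.
      * left; apply filter_one, HF0.
      * intros x y [Hx|[Y HY Hx]] Hxy; [left; now apply (filter_up F0 HF0 x)|].
        destruct (HC Y HY) as [HYf _].
        destruct (filter_up _ HYf x y (or_intror Hx) Hxy); [now left|].
        right; now exists Y.
      * assert (Hmeet : forall x y Y, C Y -> (F0 x \/ Y x) -> (F0 y \/ Y y) ->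
                  F0 (meet x y) \/ classical_sets.bigcup C (fun Z => Z) (meet x y)).
        { intros x y Y HY Hx Hy. destruct (HC Y HY) as [HYf _].
          destruct (filter_meet _ HYf x y Hx Hy); [now left|].
          right; now exists Y. }
        intros x y [Hx|[Y HY Hx]] [Hy|[Z HZ Hy]].
        -- left; now apply filter_meet.
        -- eapply Hmeet; eauto.
        -- eapply Hmeet; eauto.
        -- destruct (Htot Y Z HY HZ) as [H|H].
           ++ apply (Hmeet x y Z HZ); right; [now apply H|assumption].
           ++ apply (Hmeet x y Y HY); right; [assumption|now apply H].
    + intros x [Y HY Hx]. now apply (HC Y HY).
  - exists (fun x => F0 x \/ X x).
    split; [exact HX|split; [now left|split]].
    + intros x [Hx|Hx]; eauto.
    + intros G HG HXG HGJ x Hx. apply NNPP; intro Hn. apply (Hmax G).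
      * split; [intros y Hy; apply HXG; now right|].
        intro H. apply Hn. right. now apply H.
      * split; [|exact HGJ].
        replace (fun y => F0 y \/ G y) with G; [exact HG|].
        apply functional_extensionality; intro y.
        apply propositional_extensionality; split; [now right|].
        intros [Hy|Hy]; auto.
Qed.

(** The lattice is not assumed distributive; distributivity of [mul] over joins takes its place. If
    [p] and [q] were both outside a maximal [F], then some [m] in [F] would satisfy
    [m = mul m (join p q) <= join i j] with [i], [j] in [J]. *)
Lemma prime_filter_disjoint {A : RL} (F0 J : A -> Prop) :
  filter F0 -> ideal J -> (forall x, F0 x -> J x -> False) ->
  exists F : A -> Prop,
    prime_filter F /\ (forall x, F0 x -> F x) /\ (forall x, F x -> J x -> False).
Proof.
  intros HF0 [HJd HJj] Hdis.
  destruct (maximal_filter_disjoint F0 J HF0 Hdis) as (F & HF & H0 & HJ & Hmax).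
  exists F; split; [split; [exact HF|]|now split].
  assert (Hext : forall p, ~ F p -> le p one ->
            exists f j, F f /\ J j /\ le (meet f p) j).
  { intros p Hp Hp1. apply NNPP; intro Hn. apply Hp.
    (* This is the filter generated by [F] and [p]; were it disjoint from [J], maximality would put
       [p] in [F]. *)
    apply (Hmax (fun x => exists f, F f /\ le (meet f p) x)).
    - split.
      + exists one; split; [now apply filter_one|].
        apply le_trans with p; [apply meet_le_r|exact Hp1].
      + intros x y (f & Hf & Hx) Hxy. exists f; split; [exact Hf|].
        now apply le_trans with x.
      + intros x y (f & Hf & Hx) (g & Hg & Hy).
        exists (meet f g); split; [now apply filter_meet|].
        apply le_meet; [apply le_trans with (meet f p)|apply le_trans with (meet g p)];
          try assumption; (apply le_meet; [|apply meet_le_r]);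
          apply le_trans with (meet f g); auto using meet_le_l, meet_le_r.
    - intros x Hx. exists x; split; [exact Hx|apply meet_le_l].
    - intros x (f & Hf & Hx) Hj. apply Hn. now exists f, x.
    - exists one; split; [now apply filter_one|apply meet_le_r]. }
  intros p q Hpq.
  destruct (classic (F p)) as [|Hp]; [now left|].
  destruct (classic (F q)) as [|Hq]; [now right|exfalso].
  assert (Hp1 : le p one) by (rewrite <- Hpq; apply le_join_l).
  assert (Hq1 : le q one) by (rewrite <- Hpq; apply le_join_r).
  destruct (Hext p Hp Hp1) as (f & i & Hf & Hi & Hfi).
  destruct (Hext q Hq Hq1) as (g & j & Hg & Hj & Hgj).
  (* The meet with [one] gives [mul m x <= x], so that products with [m] can stand in for meets. *)
  set (m := meet (meet f g) one).
  assert (Hm : F m).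
  { apply (filter_meet F HF); [now apply (filter_meet F HF)|].
    now apply filter_one. }
  apply (HJ m Hm), HJd with (join i j); [now apply HJj|].
  rewrite <- (mul1r m), <- Hpq, mul_join.
  assert (Hml : forall x, le x one -> le (mul m x) m).
  { intros x Hx. rewrite <- (mul1r m) at 2. now apply mul_le_r. }
  assert (Hmr : forall x, le (mul m x) x).
  { intro x. rewrite <- (mul1 A x) at 2.
    apply mul_le; [apply meet_le_r|apply le_refl]. }
  apply join_le.
  - eapply le_trans; [|apply le_join_l]. eapply le_trans; [|exact Hfi].
    apply le_meet; [|apply Hmr]. eapply le_trans; [now apply Hml|].
    eapply le_trans; apply meet_le_l.
  - eapply le_trans; [|apply le_join_r]. eapply le_trans; [|exact Hgj].
    apply le_meet; [|apply Hmr]. eapply le_trans; [now apply Hml|].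
    eapply le_trans; [apply meet_le_l|apply meet_le_r].
Qed.


(** * Doubling an element of a chain *)

(* The order reducts of the simple idempotent chains; [c_one] covers [c_bot]. *)
Record bounded_chain : Type := {
  c_carrier : Type;
  c_le : relation c_carrier;
  c_bot : c_carrier;
  c_one : c_carrier;
  c_top : c_carrier;
  c_refl : forall x, c_le x x;
  c_trans : forall x y z, c_le x y -> c_le y z -> c_le x z;
  c_antisym : forall x y, c_le x y -> c_le y x -> x = y;
  c_total : forall x y, c_le x y \/ c_le y x;
  c_bot_le : forall x, c_le c_bot x;
  c_le_top : forall x, c_le x c_top;
  c_bot_neq_one : c_bot <> c_one;
  c_atom : forall x, x = c_bot \/ c_le c_one x
}.

Definition c_min {c : bounded_chain} (x y : c_carrier c) : c_carrier c :=
  if excluded_middle_informative (c_le c x y) then x else y.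

Definition c_max {c : bounded_chain} (x y : c_carrier c) : c_carrier c :=
  if excluded_middle_informative (c_le c x y) then y else x.

(** The formula is forced: the least element is a zero by [mul_least], and products above [one] are
    joins by [mul_eq_join]. *)
Definition c_mul {c : bounded_chain} (x y : c_carrier c) : c_carrier c :=
  if excluded_middle_informative (x = c_bot c \/ y = c_bot c) then c_bot c
  else c_max x y.

Definition c_imp {c : bounded_chain} (x y : c_carrier c) : c_carrier c :=
  if excluded_middle_informative (x = c_bot c) then c_top c
  else if excluded_middle_informative (c_le c x y) then y else c_bot c.

Lemma c_min_l {c : bounded_chain} (x y : c_carrier c) :
  c_le c x y -> c_min x y = x.
Proof.
  unfold c_min; intro H; now destruct (excluded_middle_informative _).
Qed.

Lemma c_max_r {c : bounded_chain} (x y : c_carrier c) :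
  c_le c x y -> c_max x y = y.
Proof.
  unfold c_max; intro H; now destruct (excluded_middle_informative _).
Qed.

Lemma c_min_r {c : bounded_chain} (x y : c_carrier c) :
  c_le c y x -> c_min x y = y.
Proof.
  unfold c_min; intro H; destruct (excluded_middle_informative _); [|easy].
  now apply c_antisym.
Qed.

Lemma c_max_l {c : bounded_chain} (x y : c_carrier c) :
  c_le c y x -> c_max x y = x.
Proof.
  unfold c_max; intro H; destruct (excluded_middle_informative _); [|easy].
  now apply c_antisym.
Qed.

Lemma c_min_iff {c : bounded_chain} (x y : c_carrier c) :
  c_min x y = x <-> c_le c x y.
Proof.
  split; [|apply c_min_l]. intro H. destruct (c_total c x y) as [|Hyx]; [easy|].
  rewrite c_min_r in H by exact Hyx. subst. apply c_refl.
Qed.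

Lemma c_max_le {c : bounded_chain} (x y z : c_carrier c) :
  c_le c (c_max x y) z <-> c_le c x z /\ c_le c y z.
Proof.
  destruct (c_total c x y) as [H|H]; [rewrite c_max_r|rewrite c_max_l];
    try exact H; split; try tauto; intro; split; eauto using c_trans.
Qed.

Lemma c_le_min {c : bounded_chain} (x y z : c_carrier c) :
  c_le c z (c_min x y) <-> c_le c z x /\ c_le c z y.
Proof.
  destruct (c_total c x y) as [H|H]; [rewrite c_min_l|rewrite c_min_r];
    try exact H; split; try tauto; intro; split; eauto using c_trans.
Qed.

(** With [c_max_le], this reduces the laws of [c_max] to propositional tautologies. *)
Lemma c_eq_above {c : bounded_chain} (x y : c_carrier c) :
  (forall z, c_le c x z <-> c_le c y z) -> x = y.
Proof. intro H. apply c_antisym; apply H, c_refl. Qed.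

Lemma c_eq_below {c : bounded_chain} (x y : c_carrier c) :
  (forall z, c_le c z x <-> c_le c z y) -> x = y.
Proof. intro H. apply c_antisym; apply H, c_refl. Qed.

Lemma c_le_bot {c : bounded_chain} (x : c_carrier c) :
  c_le c x (c_bot c) -> x = c_bot c.
Proof. intro H. apply c_antisym; auto using c_bot_le. Qed.

Lemma c_mul_bot_l {c : bounded_chain} (x : c_carrier c) :
  c_mul (c_bot c) x = c_bot c.
Proof.
  unfold c_mul. destruct (excluded_middle_informative _); tauto.
Qed.

Lemma c_mul_bot_r {c : bounded_chain} (x : c_carrier c) :
  c_mul x (c_bot c) = c_bot c.
Proof.
  unfold c_mul. destruct (excluded_middle_informative _); tauto.
Qed.

Lemma c_mul_max {c : bounded_chain} (x y : c_carrier c) :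
  x <> c_bot c -> y <> c_bot c -> c_mul x y = c_max x y.
Proof.
  intros. unfold c_mul. destruct (excluded_middle_informative _); tauto.
Qed.

Lemma c_max_neq_bot {c : bounded_chain} (x y : c_carrier c) :
  x <> c_bot c -> c_max x y <> c_bot c.
Proof.
  intros Hx H. apply Hx, c_le_bot. apply (proj1 (c_max_le x y (c_bot c))).
  rewrite H. apply c_refl.
Qed.

Lemma c_imp_bot {c : bounded_chain} (y : c_carrier c) :
  c_imp (c_bot c) y = c_top c.
Proof. unfold c_imp. destruct (excluded_middle_informative _); tauto. Qed.

Lemma c_imp_le {c : bounded_chain} (x y : c_carrier c) :
  x <> c_bot c -> c_le c x y -> c_imp x y = y.
Proof. intros. unfold c_imp. repeat destruct (excluded_middle_informative _); tauto. Qed.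

Lemma c_imp_nle {c : bounded_chain} (x y : c_carrier c) :
  ~ c_le c x y -> c_imp x y = c_bot c.
Proof.
  intros H. unfold c_imp. repeat destruct (excluded_middle_informative _); try tauto.
  subst. destruct H. apply c_bot_le.
Qed.

Lemma c_mul_comm {c : bounded_chain} (x y : c_carrier c) : c_mul x y = c_mul y x.
Proof.
  destruct (classic (x = c_bot c)) as [->|Hx];
    [now rewrite c_mul_bot_l, c_mul_bot_r|].
  destruct (classic (y = c_bot c)) as [->|Hy];
    [now rewrite c_mul_bot_l, c_mul_bot_r|].
  rewrite !c_mul_max by assumption.
  apply c_eq_above; intro; rewrite !c_max_le; tauto.
Qed.

Lemma c_mul_assoc {c : bounded_chain} (x y z : c_carrier c) :
  c_mul x (c_mul y z) = c_mul (c_mul x y) z.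
Proof.
  destruct (classic (x = c_bot c)) as [->|Hx]; [now rewrite !c_mul_bot_l|].
  destruct (classic (y = c_bot c)) as [->|Hy];
    [now rewrite c_mul_bot_r, !c_mul_bot_l, c_mul_bot_r|].
  destruct (classic (z = c_bot c)) as [->|Hz]; [now rewrite !c_mul_bot_r|].
  rewrite (c_mul_max x y), (c_mul_max y z) by assumption.
  rewrite !c_mul_max by auto using c_max_neq_bot.
  apply c_eq_above; intro; rewrite !c_max_le; tauto.
Qed.

Lemma c_mul_one {c : bounded_chain} (x : c_carrier c) : c_mul (c_one c) x = x.
Proof.
  destruct (c_atom c x) as [->|Hx]; [apply c_mul_bot_r|].
  destruct (classic (x = c_bot c)) as [->|Hx']; [apply c_mul_bot_r|].
  rewrite c_mul_max; auto using c_max_r. apply not_eq_sym, c_bot_neq_one.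
Qed.

Lemma c_residuation {c : bounded_chain} (x y z : c_carrier c) :
  c_le c (c_mul x y) z <-> c_le c y (c_imp x z).
Proof.
  destruct (classic (x = c_bot c)) as [->|Hx].
  { rewrite c_mul_bot_l, c_imp_bot.
    split; intro; auto using c_bot_le, c_le_top. }
  destruct (classic (y = c_bot c)) as [->|Hy].
  { rewrite c_mul_bot_r. split; intro; auto using c_bot_le. }
  rewrite c_mul_max, c_max_le by assumption.
  destruct (classic (c_le c x z)) as [H|H].
  - rewrite c_imp_le by assumption. tauto.
  - rewrite c_imp_nle by assumption. split; [tauto|].
    intro Hb. now apply c_le_bot in Hb.
Qed.

Definition chain_RL (c : bounded_chain) : RL.
Proof.
  refine (mkRL (c_carrier c) c_mul c_imp c_min c_max (c_one c)
            c_mul_assoc c_mul_comm c_mul_one _ _ _ _ _ _ _).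
  - intros; apply c_eq_below; intro; rewrite !c_le_min; tauto.
  - intros; apply c_eq_below; intro; rewrite !c_le_min; tauto.
  - intros; apply c_eq_above; intro; rewrite !c_max_le; tauto.
  - intros; apply c_eq_above; intro; rewrite !c_max_le; tauto.
  - intros x y; apply c_min_iff. apply (proj1 (c_max_le x y _)), c_refl.
  - intros x y; apply c_max_l. apply (proj1 (c_le_min x y _)), c_refl.
  - intros. rewrite !c_min_iff. apply c_residuation.
Defined.

Lemma chain_RL_simple (c : bounded_chain) : simple_idempotent_chain (chain_RL c).
Proof.
  apply (simple_chainI (chain_RL c) (c_bot c)).
  - intros x y. unfold le. simpl. rewrite !c_min_iff. apply c_total.
  - intro x; simpl. destruct (classic (x = c_bot c)) as [->|H].
    + apply c_mul_bot_l.
    + rewrite c_mul_max by assumption. apply c_max_l, c_refl.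
  - intros a Ha. unfold le in *; simpl in *.
    apply c_min_iff in Ha. destruct (c_atom c a) as [->|H].
    + right; intro; apply c_min_iff, c_bot_le.
    + left; now apply c_antisym.
  - apply c_bot_neq_one.
Qed.

(* In a simple idempotent chain the operations are determined by the order
   and its three constants, so an order embedding is a homomorphism. *)
Lemma chain_embedding_hom (A : RL) (bot top : A) (c : bounded_chain)
  (phi : A -> c_carrier c) :
  totally_ordered A -> idempotent A -> least_below_one A ->
  (forall x, le bot x) -> (forall x, le x top) ->
  (forall x y, le x y <-> c_le c (phi x) (phi y)) ->
  phi bot = c_bot c -> phi one = c_one c -> phi top = c_top c ->
  exists g : hom A (chain_RL c), forall x, g x = phi x.
Proof.
  intros Ht Hi Hl Hb Htop Hphi Ebot Eone Etop.
  assert (Hinj : forall x, phi x = c_bot c -> x = bot).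
  { intros x Hx. apply le_antisym; [|apply Hb].
    apply Hphi. rewrite Hx. apply c_bot_le. }
  assert (Hjoin : forall x y, phi (join x y) = c_max (phi x) (phi y)).
  { intros x y. destruct (Ht x y) as [H|H].
    - rewrite join_eq_r, c_max_r; auto; now apply Hphi.
    - rewrite join_eq_l, c_max_l; auto; now apply Hphi. }
  unshelve eexists.
  - refine (mkHom A (chain_RL c) phi _ _ _ _ _).
    + intros x y; simpl.
      destruct (bot_or_one_le bot x Ht Hl Hb) as [->|Hx].
      { now rewrite mul_least, Ebot, c_mul_bot_l by exact Hb. }
      destruct (bot_or_one_le bot y Ht Hl Hb) as [->|Hy].
      { now rewrite mulC, mul_least, Ebot, c_mul_bot_r by exact Hb. }
      assert (Hne : forall z, le one z -> phi z <> c_bot c).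
      { intros z Hz E. apply Hinj in E. subst z.
        apply (c_bot_neq_one c). rewrite <- Ebot, <- Eone.
        f_equal. now apply le_antisym. }
      rewrite mul_eq_join, c_mul_max by auto. apply Hjoin.
    + intros x y; simpl.
      destruct (bot_or_one_le bot x Ht Hl Hb) as [->|Hx].
      { rewrite Ebot, c_imp_bot, <- Etop. f_equal.
        apply le_antisym; [apply Htop|]. apply le_imp.
        rewrite mul_least by exact Hb. apply Hb. }
      destruct (classic (le x y)) as [Hxy|Hxy].
      * rewrite c_imp_le.
        -- f_equal. apply le_antisym.
           ++ eapply le_trans; [|apply (mul_imp_le x)].
              rewrite <- (mul1 A (imp x y)) at 1.
              apply mul_le; [exact Hx|apply le_refl].
           ++ apply le_imp. rewrite mul_eq_join; auto.
              ** now rewrite join_eq_r by exact Hxy; apply le_refl.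
              ** now apply le_trans with x.
        -- intro E. apply Hinj in E. subst x.
           apply (c_bot_neq_one c). rewrite <- Ebot, <- Eone.
           f_equal. now apply le_antisym.
        -- now apply Hphi.
      (* When [x <= y] fails, [imp x y] is not above [one], which leaves only the least element. *)
      * rewrite c_imp_nle by (now rewrite <- Hphi). rewrite <- Ebot. f_equal.
        destruct (bot_or_one_le bot (imp x y) Ht Hl Hb) as [|H]; [easy|].
        destruct Hxy. now apply one_le_imp.
    + intros x y; simpl. destruct (Ht x y) as [H|H].
      * rewrite meet_eq_l, c_min_l; auto; now apply Hphi.
      * rewrite meet_eq_r, c_min_r; auto; now apply Hphi.
    + exact Hjoin.
    + exact Eone.
  - reflexivity.
Qed.

(* [None] is a new element placed immediately above [b]. *)
Definition double_le {A : RL} (b : A) (x y : option A) : Prop :=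
  match x, y with
  | Some x, Some y => le x y
  | Some x, None => le x b
  | None, Some y => ~ le y b
  | None, None => True
  end.

(** [b <> top] keeps the new element below [Some top]; [b <> bot] puts [b], and with it the new
    element, above [one]. *)
Definition double_chain (A : RL) (bot top b : A)
  (Ht : totally_ordered A) (Hl : least_below_one A)
  (Hb : forall x, le bot x) (Htop : forall x, le x top)
  (Hbo : bot <> one) (Hbb : b <> bot) (Hbt : b <> top) : bounded_chain.
Proof.
  refine (Build_bounded_chain (option A) (double_le b)
            (Some bot) (Some one) (Some top) _ _ _ _ _ _ _ _).
  - intros [x|]; simpl; auto using le_refl.
  - intros [x|] [y|] [z|]; simpl; eauto using le_trans; intros H1 H2.
    destruct (Ht x z) as [|H]; [easy|].
    destruct H2; now apply le_trans with x.
  - intros [x|] [y|]; simpl; try tauto. intros; f_equal; now apply le_antisym.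
  - intros [x|] [y|]; simpl; auto; tauto.
  - intros [x|]; simpl; auto.
  - intros [x|]; simpl; auto. intro H. apply Hbt; now apply le_antisym.
  - congruence.
  - intros [x|]; simpl.
    + destruct (bot_or_one_le bot x Ht Hl Hb) as [->|]; auto.
    + destruct (bot_or_one_le bot b Ht Hl Hb); tauto.
Defined.

(** The embedding [Some] and its variant sending [b] to [None] both preserve and reflect the order.
    The constants have to stay fixed, so [b] must be none of them. *)
Lemma chain_separation (A : RL) (bot top b : A) :
  totally_ordered A -> idempotent A -> least_below_one A ->
  (forall x, le bot x) -> (forall x, le x top) ->
  b <> bot -> b <> one -> b <> top ->
  exists (C : RL) (g h : hom A C), simple_idempotent_chain C /\
    (forall x, x <> b -> g x = h x) /\ g b <> h b.
Proof.
  intros Ht Hi Hl Hb Htop Hbb Hbo Hbt.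
  (* Otherwise [top = mul one top = mul bot top = bot] and the chain is trivial. *)
  assert (Hbot1 : bot <> one).
  { intros E. apply Hbt. apply le_antisym; [apply Htop|].
    rewrite <- (mul1 A top), <- E, mul_least by exact Hb. apply Hb. }
  pose (c := double_chain A bot top b Ht Hl Hb Htop Hbot1 Hbb Hbt).
  pose (phi := fun x : A =>
    if excluded_middle_informative (x = b) then None else Some x).
  assert (Ephi : forall x, x <> b -> phi x = Some x).
  { intros x Hx. unfold phi. now destruct (excluded_middle_informative _). }
  assert (Ephib : phi b = None).
  { unfold phi. now destruct (excluded_middle_informative _). }
  destruct (chain_embedding_hom A bot top c Some) as [g Hg]; auto.
  { intros; reflexivity. }
  destruct (chain_embedding_hom A bot top c phi) as [h Hh]; auto;
    try (apply Ephi; congruence).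
  { intros x y. destruct (classic (x = b)) as [->|Hx];
      destruct (classic (y = b)) as [->|Hy];
      rewrite ?Ephib, ?Ephi by assumption; simpl.
    - split; auto using le_refl.
    - split.
      + intros H H'. apply Hy. now apply le_antisym.
      + intro H. destruct (Ht b y); tauto.
    - reflexivity.
    - reflexivity. }
  exists (chain_RL c), g, h. split; [apply chain_RL_simple|split].
  - intros x Hx. now rewrite Hg, Hh, Ephi.
  - rewrite Hg, Hh, Ephib. discriminate.
Qed.


(** * The variety generated by the simple idempotent chains *)

Lemma generated_idempotent (A : RL) :
  generated_variety simple_idempotent_chain A -> idempotent A.
Proof.
  intros HA a.
  refine (generated_equation _ (tMul (tVar 0) (tVar 0)) (tVar 0) _ A HA
            (fun _ => a)).
  intros B (_ & _ & Hi) v. apply Hi.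
Qed.

(** In a chain one of the two implications is above [one]. Primeness turns this cover of [one] into
    totality of the quotient. *)
Lemma generated_prelinear (A : RL) (x y : A) :
  generated_variety simple_idempotent_chain A ->
  join (meet (imp x y) one) (meet (imp y x) one) = one.
Proof.
  intro HA.
  refine (generated_equation _
    (tJoin (tMeet (tImp (tVar 0) (tVar 1)) tOne)
           (tMeet (tImp (tVar 1) (tVar 0)) tOne)) tOne _ A HA
    (fun n => match n with 0 => x | _ => y end)).
  clear; intros B (_ & Ht & _) v; simpl.
  destruct (Ht (v 0) (v 1)) as [H|H]; apply one_le_imp in H.
  - rewrite (meet_eq_r (imp (v 0) (v 1))) by exact H.
    apply join_eq_l, meet_le_r.
  - rewrite (meet_eq_r (imp (v 1) (v 0))) by exact H.
    apply join_eq_r, meet_le_r.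
Qed.

Lemma generated_complement (A : RL) (p x : A) :
  generated_variety simple_idempotent_chain A -> le p one ->
  join p (meet (imp p x) one) = one.
Proof.
  (* An equation is tested at every valuation, so the side condition [p <= one] is absorbed into the
     term [meet p one]. *)
  intros HA Hp. rewrite <- (meet_eq_l p one) by exact Hp.
  refine (generated_equation _
    (tJoin (tMeet (tVar 0) tOne)
           (tMeet (tImp (tMeet (tVar 0) tOne) (tVar 1)) tOne)) tOne _ A HA
    (fun n => match n with 0 => p | _ => x end)).
  clear; intros B HB v; simpl. generalize (v 1); intro x.
  destruct (simple_chain_least_below_one B HB _ (meet_le_r (v 0) one)) as [->|H].
  - apply join_eq_l, meet_le_r.
  - rewrite (meet_eq_r (imp _ x)) by apply one_le_imp, H.
    apply join_eq_r, meet_le_r.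
Qed.

(** A negative element measuring equality: it is [one] exactly when [x = y], and a filter contains
    it exactly when it identifies [x] and [y]. *)
Definition agree {A : RL} (x y : A) : A :=
  meet (meet (imp x y) (imp y x)) one.

(* In a simple idempotent chain, and for [p <= one], this is [x] when
   [p = one] and [y] when [p] is the least element. *)
Definition switch {A : RL} (p x y : A) : A :=
  meet (imp p x) (join (mul p x) y).

Lemma agree_le_one {A : RL} (x y : A) : le (agree x y) one.
Proof. apply meet_le_r. Qed.

Lemma agree_eq {A : RL} (x y : A) : le one (agree x y) -> x = y.
Proof.
  intro H.
  assert (H' : le one (meet (imp x y) (imp y x)))
    by (apply le_trans with (agree x y); [exact H|apply meet_le_l]).
  apply le_antisym; apply one_le_imp;
    (eapply le_trans; [exact H'|]); [apply meet_le_l|apply meet_le_r].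
Qed.

Lemma switch_one {A : RL} (x y : A) : switch one x y = x.
Proof. unfold switch. rewrite imp_one_l, mul1. apply meetK. Qed.

Lemma switch_least {A : RL} (p x y : A) :
  (forall z, le p z) -> switch p x y = y.
Proof.
  intro Hp. unfold switch. rewrite mul_least by exact Hp.
  rewrite (join_eq_r p y) by apply Hp. apply meet_eq_r, le_imp.
  rewrite mul_least by exact Hp. apply Hp.
Qed.

Definition tAgree (s t : term) : term :=
  tMeet (tMeet (tImp s t) (tImp t s)) tOne.

Definition tSwitch (p s t : term) : term :=
  tMeet (tImp p s) (tJoin (tMul p s) t).

(** Merges two approximations of [w] into one that is at least as good as either. In a simple chain
    [agree u w] is [one], and the switch returns [u], or it is least, and the switch returns [v]. *)
Lemma generated_switch (A : RL) (u v w : A) :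
  generated_variety simple_idempotent_chain A ->
  le (agree u w) (agree (switch (agree u w) u v) w) /\
  le (agree v w) (agree (switch (agree u w) u v) w).
Proof.
  intro HA.
  assert (Hchain : forall B, simple_idempotent_chain B -> forall u v w : B,
    le (agree u w) (agree (switch (agree u w) u v) w) /\
    le (agree v w) (agree (switch (agree u w) u v) w)).
  { clear; intros B HB u v w.
    destruct (simple_chain_least_below_one B HB _ (agree_le_one u w)) as [E|Hle].
    - rewrite E, switch_one, E. split; [apply le_refl|apply agree_le_one].
    - split; [apply Hle|]. rewrite switch_least by exact Hle. apply le_refl. }
  pose (a := tAgree (tVar 0) (tVar 2)).
  pose (b := tAgree (tSwitch a (tVar 0) (tVar 1)) (tVar 2)).
  pose (a' := tAgree (tVar 1) (tVar 2)).
  pose (val := fun n => match n with 0 => u | 1 => v | _ => w end).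
  split.
  - apply (generated_equation simple_idempotent_chain (tMeet a b) a)
      with (v := val); [|exact HA].
    intros B HB k. apply (Hchain B HB (k 0) (k 1) (k 2)).
  - apply (generated_equation simple_idempotent_chain (tMeet a' b) a')
      with (v := val); [|exact HA].
    intros B HB k. apply (Hchain B HB (k 0) (k 1) (k 2)).
Qed.

(** Primeness is applied to the covers of [one] given by [generated_prelinear] and
    [generated_complement]. Simplicity is not claimed: an improper [P] gives the trivial algebra. *)
Lemma prime_quotient_chain (A : RL) (P : A -> Prop) Hi HF :
  generated_variety simple_idempotent_chain A -> prime_filter P ->
  totally_ordered (quotient P Hi HF) /\ idempotent (quotient P Hi HF) /\
  least_below_one (quotient P Hi HF).
Proof.
  intros HA [_ HP]. split; [|split].
  - intros X Y. destruct (quotient_map_surj P Hi HF X) as [x ->].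
    destruct (quotient_map_surj P Hi HF Y) as [y ->].
    rewrite !quotient_map_le.
    destruct (HP _ _ (generated_prelinear A x y HA)) as [H|H]; [left|right];
      apply (filter_up P HF _ _ H), meet_le_l.
  - intros X. destruct (quotient_map_surj P Hi HF X) as [x ->].
    rewrite <- hom_mul. f_equal. apply Hi.
  - intros X HX. destruct (quotient_map_surj P Hi HF X) as [x ->].
    (* A class below [one] has a representative in the negative cone, where [filter_eq_one] and
       [generated_complement] apply. *)
    set (p := meet x one).
    assert (E : quotient_map P Hi HF x = quotient_map P Hi HF p).
    { unfold p. rewrite hom_meet, hom_one. symmetry. exact HX. }
    rewrite E. destruct (classic (P p)) as [Hp|Hp].
    + left. rewrite <- (hom_one _ _ (quotient_map P Hi HF)).
      apply quotient_map_eq, filter_eq_one; [exact HF|apply meet_le_r|exact Hp].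
    + right. intro Y. destruct (quotient_map_surj P Hi HF Y) as [y ->].
      apply quotient_map_le.
      destruct (HP _ _ (generated_complement A p y HA (meet_le_r x one)))
        as [H|H]; [easy|].
      apply (filter_up P HF _ _ H), meet_le_l.
Qed.

(** * Epimorphisms *)

(** If the image of [A] missed a class, two homomorphisms from the quotient would agree on that
    image and differ at the class. *)
Lemma epimorphism_onto_prime_quotient (A B : RL) (f : hom A B) (P : B -> Prop) :
  generated_variety simple_idempotent_chain B ->
  epimorphism (generated_variety simple_idempotent_chain) f ->
  prime_filter P -> forall b, exists a, filter_eq P (f a) b.
Proof.
  intros HB Hepi HP b.
  pose proof (generated_idempotent B HB) as Hi. pose proof (proj1 HP) as HF.
  destruct (prime_quotient_chain B P Hi HF HB HP) as (Ht & HiD & Hl).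
  set (D := quotient P Hi HF) in *. set (pi := quotient_map P Hi HF : hom B D).
  apply NNPP; intro Hn.
  assert (Hb : forall a, pi (f a) <> pi b).
  { intros a E. apply Hn. exists a. now apply (quotient_map_eq P Hi HF). }
  assert (Hb1 : pi b <> one).
  { intro E. apply (Hb one). now rewrite !hom_one. }
  destruct (classic (exists a, pi (f a) <> one)) as [[a Ha]|Htriv].
  - (* [a] is sent away from [one], so the image of [A] in the quotient
       contains both bounds. *)
    set (bot := meet a (imp a one)).
    (* One of [a] and [imp a one] is sent below [one], and their meet is sent to [one] only if [a]
       is. *)
    assert (Hbot : forall x, le (pi (f bot)) x).
    { destruct (Hl (pi (f bot))) as [E|]; [| |assumption].
      - unfold bot. rewrite !hom_meet, !hom_imp, !hom_one.
        destruct (Ht (pi (f a)) one) as [H|H].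
        + eapply le_trans; [apply meet_le_l|exact H].
        + eapply le_trans; [apply meet_le_r|].
          rewrite <- (mul1 D (imp _ _)).
          eapply le_trans; [|apply (mul_imp_le (pi (f a)))].
          apply mul_le; [exact H|apply le_refl].
      - exfalso. apply Ha. unfold bot in E.
        rewrite !hom_meet, !hom_imp, !hom_one in E. apply le_antisym.
        + apply one_le_imp. rewrite <- E at 1. apply meet_le_r.
        + rewrite <- E at 1. apply meet_le_l. }
    set (top := imp bot bot).
    assert (Htop : forall x, le x (pi (f top))).
    { intro x. unfold top. rewrite !hom_imp. apply le_imp.
      rewrite mul_least by exact Hbot. apply le_refl. }
    destruct (chain_separation D (pi (f bot)) (pi (f top)) (pi b))
      as (C & g & h & HC & Hgh & Hne); auto using not_eq_sym.
    apply Hne.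
    apply (Hepi C (simple_chain_generated C HC) (hom_comp g pi) (hom_comp h pi)).
    intro x. apply Hgh, Hb.
  (* The image of [A] in the quotient is just [one], so the projection and the constant map agree on
     it; [pi b <> one] makes the quotient simple. *)
  - apply Hb1.
    apply (Hepi D) with (g := pi) (h := hom_const_one B D).
    + now apply simple_chain_generated, (simple_chainI D (pi b)).
    + intro x. apply NNPP; intro Hx. apply Htriv. now exists x.
Qed.

(* Since [A] maps onto [B/P], an inclusion of [P] into [Q] over [A] makes the
   projection of [A] to [B/Q] factor through [B/P]; this gives a second
   homomorphism from [B] to [B/Q] besides the projection. *)
Lemma epimorphism_prime_filters (A B : RL) (f : hom A B) (P Q : B -> Prop) :
  generated_variety simple_idempotent_chain B ->
  epimorphism (generated_variety simple_idempotent_chain) f ->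
  prime_filter P -> prime_filter Q -> (forall a, P (f a) -> Q (f a)) ->
  forall p, le p one -> P p -> Q p.
Proof.
  intros HB Hepi HP HQ HPQ p Hp HPp. apply NNPP; intro HQp. apply HQp.
  pose proof (generated_idempotent B HB) as Hi.
  pose proof (proj1 HP) as FP. pose proof (proj1 HQ) as FQ.
  pose proof (epimorphism_onto_prime_quotient A B f P HB Hepi HP) as Hsurj.
  destruct (filter_eq_equiv P Hi FP) as [Rr Rt Rs].
  pose proof (filter_eq_congruence P Hi FP) as [_ Cmul Cimp Cmeet Cjoin].
  destruct (prime_quotient_chain B Q Hi FQ HB HQ) as (Ht & HiD & Hl).
  set (D := quotient Q Hi FQ) in *. set (pi := quotient_map Q Hi FQ : hom B D).
  assert (Htransfer : forall a a', filter_eq P (f a) (f a') ->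
                                   pi (f a) = pi (f a')).
  { intros a a' [H1 H2]. apply (quotient_map_eq Q Hi FQ).
    unfold filter_le in *. rewrite <- hom_imp in H1, H2.
    split; unfold filter_le; rewrite <- hom_imp; now apply HPQ. }
  (* Preimages modulo [P] are chosen arbitrarily; [Htransfer] makes their images in [D] independent
     of the choice. *)
  pose (lift := fun b => proj1_sig (constructive_indefinite_description _ (Hsurj b))).
  assert (Hlift : forall b, filter_eq P (f (lift b)) b).
  { intro b. exact (proj2_sig (constructive_indefinite_description _ (Hsurj b))). }
  assert (Hop : forall (opA : A -> A -> A) (opB : B -> B -> B),
            compatible (filter_eq P) opB ->
            (forall x y, f (opA x y) = opB (f x) (f y)) -> forall x y,
            pi (f (lift (opB x y))) = pi (f (opA (lift x) (lift y)))).
  { intros opA opB HopB Hf x y. apply Htransfer. rewrite Hf.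
    eapply Rt; [apply Hlift|]. apply Rs, HopB; apply Hlift. }
  assert (Hh : exists h : hom B D, forall b, h b = pi (f (lift b))).
  { unshelve eexists (mkHom B D (fun b => pi (f (lift b))) _ _ _ _ _).
    6: reflexivity.
    all: cbv beta; intros.
    - now rewrite (Hop _ _ Cmul (hom_mul _ _ f)), !hom_mul.
    - now rewrite (Hop _ _ Cimp (hom_imp _ _ f)), !hom_imp.
    - now rewrite (Hop _ _ Cmeet (hom_meet _ _ f)), !hom_meet.
    - now rewrite (Hop _ _ Cjoin (hom_join _ _ f)), !hom_join.
    - rewrite <- (hom_one _ _ pi), <- (hom_one _ _ f). apply Htransfer, Hlift. }
  destruct Hh as [h Hh].
  (* The assumption that [p] is outside [Q] makes [D] nontrivial, hence simple. *)
  assert (HD : simple_idempotent_chain D).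
  { apply (simple_chainI D (pi p)); auto.
    rewrite <- (hom_one _ _ pi). intro E. apply HQp.
    apply (filter_eq_one Q p FQ Hp). now apply (quotient_map_eq Q Hi FQ). }
  assert (E : pi p = h p).
  { apply (Hepi D (simple_chain_generated D HD)).
    intro a. rewrite Hh. symmetry. apply Htransfer, Hlift. }
  apply (filter_eq_one Q p FQ Hp), (quotient_map_eq Q Hi FQ).
  change (pi p = pi one). rewrite E, Hh, <- (hom_one _ _ f). apply Htransfer.
  eapply Rt; [apply Hlift|]. rewrite hom_one. now apply filter_eq_one.
Qed.

Lemma epimorphism_negative_cone (A B : RL) (f : hom A B) :
  generated_variety simple_idempotent_chain B ->
  epimorphism (generated_variety simple_idempotent_chain) f ->
  forall p, le p one -> exists a, f a = p.
Proof.
  intros HB Hepi p Hp. apply NNPP; intro Hn.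
  (* [P] contains [p] but no image of an element of [A] lying below [p]. *)
  destruct (prime_filter_disjoint (le p)
              (fun x => exists a, le x (f a) /\ le (f a) p))
    as (P & HP & HpP & HPJ).
  - split; [exact Hp|intros; eauto using le_trans|intros; now apply le_meet].
  - split.
    + intros x y (a & Hy & Ha) Hxy. exists a; split; eauto using le_trans.
    + intros x y (a & Hx & Ha) (a' & Hy & Ha'). exists (join a a').
      rewrite hom_join. split; [|now apply join_le].
      apply join_le; eapply le_trans; try eassumption;
        [apply le_join_l|apply le_join_r].
  - intros x Hx (a & Hxa & Ha). apply Hn. exists a.
    apply le_antisym; [exact Ha|now apply le_trans with x].
  - pose proof (proj1 HP) as FP.
    (* [Q] extends the trace of [P] on the image of [f] yet omits [p], which
       [epimorphism_prime_filters] forbids. *)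
    destruct (prime_filter_disjoint (fun x => exists a, P (f a) /\ le (f a) x)
                (fun x => le x p)) as (Q & HQ & HPQ & HQp).
    + split.
      * exists one. rewrite hom_one.
        split; [now apply filter_one|apply le_refl].
      * intros x y (a & Ha & Hx) Hxy. exists a; split; eauto using le_trans.
      * intros x y (a & Ha & Hx) (a' & Ha' & Hy). exists (meet a a').
        rewrite hom_meet. split; [now apply (filter_meet P FP)|].
        apply le_meet; [apply le_trans with (f a)|apply le_trans with (f a')];
          auto using meet_le_l, meet_le_r.
    + split; [eauto using le_trans|intros; now apply join_le].
    + intros x (a & Ha & Hx) Hxp. apply (HPJ (f a) Ha).
      exists a; split; [apply le_refl|now apply le_trans with x].
    + apply (HQp p); [|apply le_refl].
      apply (epimorphism_prime_filters A B f P Q); auto using le_refl.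
      intros a Ha. apply HPQ. exists a; split; [exact Ha|apply le_refl].
Qed.

Theorem theorem6p14 : ES_property (generated_variety simple_idempotent_chain).
Proof.
  intros A B HA HB f Hepi b. apply NNPP; intro Hn.
  (* Without a preimage of [b], the elements below some [agree (f a) b] form an ideal that avoids
     [one]. *)
  destruct (prime_filter_disjoint (le one)
              (fun x => exists a, le x (agree (f a) b))) as (P & HP & _ & HPJ).
  - split; [apply le_refl|intros; eauto using le_trans|intros; now apply le_meet].
  - split.
    + intros x y (a & Hy) Hxy. exists a. now apply le_trans with y.
    + intros x y (a & Hx) (a' & Hy).
      (* The control parameter of the switch is negative, hence an image, so the switch can be
         formed in [A] already; this closes the ideal under joins. *)
      destruct (epimorphism_negative_cone A B f HB Hepi _ (agree_le_one (f a) b))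
        as [p Hp].
      destruct (generated_switch B (f a) (f a') b HB) as [H1 H2].
      exists (switch p a a'). unfold switch.
      rewrite hom_meet, hom_imp, hom_join, hom_mul, Hp.
      apply join_le; eauto using le_trans.
  - intros x Hx (a & Ha). apply Hn. exists a.
    apply agree_eq. now apply le_trans with x.
  (* A preimage of [b] modulo [P] puts [agree (f a) b] in [P], although it lies in the ideal. *)
  - destruct (epimorphism_onto_prime_quotient A B f P HB Hepi HP b) as [a [H1 H2]].
    apply (HPJ (agree (f a) b)); [|exists a; apply le_refl].
    apply (filter_meet P (proj1 HP)); [|apply filter_one, HP].
    now apply (filter_meet P (proj1 HP)).
Qed.
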